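(* Suppose that $aT$, $a\in A$, is an abstract weighted shift operator on a Banach space $E$ and $\alpha:A\to A$ is an associated endomorphism. Then for the spectral radius $r(aT)$ of the operator $aT$ we have $$r(aT)=r(a\alpha)=\lim_{n\to\infty}\|a\,\alpha(a)\cdots\alpha^n(a)\|^{\frac1n},$$ where $r(a\alpha)$ is the spectral radius of the weighted endomorphism $a\alpha:A\to A$ treated as an element of $\mathcal{B}(A)$. In particular, $r(aT)=r(\alpha^k(a)T)=r(\alpha^k(a)\alpha)$ for every $k\in\mathbb{N}$.
   Context: For a Banach space $E$, operators $T,S\in\mathcal{B}(E)$ are called mutually adjoint partial isometries if both are contractions and $TST=T$, $STS=S$. Let $A\subseteq\mathcal{B}(E)$ be an algebra containing $1\in\mathcal{B}(E)$ and let $T\in\mathcal{B}(E)$ be a partial isometry which admits an adjoint partial isometry $S$ with $TAS\subseteq A$ and $ST\in A'$ (the commutant of $A$). Then $\alpha(a):=TaS$, $a\in A$, is an endomorphism of $A$, and the operators $aT$, $a\in A$, are called (abstract) weighted shift operators associated with the endomorphism $\alpha$. The weighted endomorphism $a\alpha$ is the operator $b\mapsto a\,\alpha(b)$ on $A$. *)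

(* Defs.v *)
From HB Require Import structures.
From mathcomp Require Export all_boot all_order all_algebra.
From mathcomp Require Export all_classical all_reals all_analysis.
From mathcomp Require Export complex.

Set Implicit Arguments.
Unset Strict Implicit.
Unset Printing Implicit Defensive.

Import Order.TTheory GRing.Theory Num.Theory.
Import numFieldNormedType.Exports.

Local Open Scope classical_set_scope.
Local Open Scope complex_scope.
Local Open Scope ring_scope.

(* In a normed module over [R[i]] the library norm [`|x|] takes values in
   [R[i]]; [rnorm] is the same norm with values in [R] (see [rnormE]). *)
Definition rnorm {R : realType} {V : normedModType R[i]} (x : V) : R :=
  complex.Re `|x|.

Section RNorm.
Variables (R : realType) (V : normedModType R[i]).
Implicit Types (x y : V) (l : R[i]).

Lemma cnormE l : `|l| = (complex.Re `|l|)%:C.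
Proof. by apply/esym; apply: RRe_real; exact: normr_real. Qed.

Lemma cnorm_ge0 l : 0 <= complex.Re `|l|.
Proof. by rewrite -ler0c -cnormE; exact: normr_ge0. Qed.

Lemma rnormE x : `|x| = (rnorm x)%:C.
Proof. by apply/esym; apply: RRe_real; exact: normr_real. Qed.

Lemma rnorm_ge0 x : 0 <= rnorm x.
Proof. by rewrite -ler0c -rnormE; exact: normr_ge0. Qed.

Lemma rnormD x y : rnorm (x + y) <= rnorm x + rnorm y.
Proof. by rewrite -lecR rmorphD /= -!rnormE; exact: ler_normD. Qed.

Lemma rnormZ l x : rnorm (l *: x) = complex.Re `|l| * rnorm x.
Proof. by apply: complexI; rewrite rmorphM /= -!rnormE -cnormE; exact: normrZ. Qed.

Lemma rnorm0 : rnorm (0 : V) = 0.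
Proof. by rewrite /rnorm normr0. Qed.

Lemma rnorm_eq0 x : rnorm x = 0 -> x = 0.
Proof. by move=> x0; apply: normr0_eq0; rewrite rnormE x0. Qed.

End RNorm.

Section BoundedOperators.
Variables (R : realType) (V : normedModType R[i]).
Implicit Types (f g : V -> V).

Definition bounded_operator f : Prop :=
  (forall (l : R[i]) x y, f (l *: x + y) = l *: f x + f y) /\
  exists M : R, forall x, rnorm (f x) <= M * rnorm x.

Record bop : Type :=
  BOp { bop_fun :> V -> V ; _ : bop_fun \in [set f | bounded_operator f] }.

Implicit Types x y : bop.

HB.instance Definition _ := [isSub for bop_fun].
HB.instance Definition _ := [Choice of bop by <:].

Definition mkbop f (hf : bounded_operator f) : bop := BOp (mem_set hf).

Lemma bopP (x : bop) : bounded_operator x.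
Proof. by case: x => f /= /set_mem. Qed.

Lemma bopext (x y : bop) : (forall v, x v = y v) -> x = y.
Proof. by move=> xy; apply: val_inj; apply/funext. Qed.

Fact bop_submod_closed :
  GRing.submod_closed (fun f => f \in [set f | bounded_operator f]).
Proof.
split.
- apply/mem_set; split=> [l x y|]; first by rewrite scaler0 addr0.
  by exists 0 => x; rewrite mul0r rnorm0.
- move=> l f g /set_mem[fl [M fM]] /set_mem[gl [N gN]]; apply/mem_set; split.
    move=> c x y; rewrite [LHS]/= !fctE /= fl gl !scalerDr !scalerA.
    by rewrite (mulrC l c) -!addrA; congr (_ + _); rewrite addrCA.
  exists (complex.Re `|l| * M + N) => x; rewrite [X in rnorm X]/=.
  apply: le_trans (rnormD _ _) _; rewrite mulrDl lerD // rnormZ -mulrA.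
  by rewrite ler_wpM2l // cnorm_ge0.
Qed.

HB.instance Definition _ :=
  GRing.SubChoice_isSubLmodule.Build R[i] (V -> V) _ bop bop_submod_closed.

Fact bop1_subproof : bounded_operator id.
Proof. by split=> //; exists 1 => x; rewrite mul1r. Qed.

Fact bopM_subproof (x y : bop) : bounded_operator (x \o y).
Proof.
have [xl [M xM]] := bopP x; have [yl [N yN]] := bopP y; split.
  by move=> l u v /=; rewrite yl xl.
exists (Num.max M 0 * N) => u /=; apply: le_trans (xM _) _.
rewrite -mulrA; apply: (@le_trans _ _ (Num.max M 0 * rnorm (y u))).
  by rewrite ler_wpM2r ?rnorm_ge0 // le_max lexx.
by rewrite ler_wpM2l // le_max lexx orbT.
Qed.

Definition bop1 : bop := mkbop bop1_subproof.
Definition bopM (x y : bop) : bop := mkbop (bopM_subproof x y).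

Lemma bopDE (x y : bop) v : (x + y) v = x v + y v. Proof. by []. Qed.

Lemma bopZE (l : R[i]) (x : bop) v : (l *: x) v = l *: x v. Proof. by []. Qed.

Lemma bopD (x : bop) u v : x (u + v) = x u + x v.
Proof. by have [xl _] := bopP x; have := xl 1 u v; rewrite !scale1r. Qed.

Lemma bop0 (x : bop) : x 0 = 0.
Proof.
by apply: (addIr (x 0)); rewrite -bopD addr0 add0r.
Qed.

Lemma bopZ (x : bop) l v : x (l *: v) = l *: x v.
Proof. by have [xl _] := bopP x; have := xl l v 0; rewrite !addr0 bop0 addr0. Qed.

Fact bopMA : associative bopM. Proof. by move=> x y z; exact: bopext. Qed.
Fact bop1M : left_id bop1 bopM. Proof. by move=> x; exact: bopext. Qed.
Fact bopM1 : right_id bop1 bopM. Proof. by move=> x; exact: bopext. Qed.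
Fact bopMDl : left_distributive bopM +%R.
Proof. by move=> x y z; apply: bopext => v. Qed.
Fact bopMDr : right_distributive bopM +%R.
Proof. by move=> x y z; apply: bopext => v; rewrite /= bopD. Qed.

(* Only a [pzRingType]: [bop] is the zero ring when [V] is trivial. *)
HB.instance Definition _ :=
  GRing.Zmodule_isPzRing.Build bop bopMA bop1M bopM1 bopMDl bopMDr.

Definition opnorm (x : bop) : R :=
  sup [set rnorm (x v) | v in [set v : V | rnorm v <= 1]].

Let opnorm_set (x : bop) := [set rnorm (x v) | v in [set v : V | rnorm v <= 1]].

Fact opnorm_has_sup x : has_sup (opnorm_set x).
Proof.
split; first by exists (rnorm (x 0)); exists 0 => //=; rewrite rnorm0.
have [_ [M xM]] := bopP x; exists (Num.max M 0) => _ [v /= v1 <-].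
apply: le_trans (xM v) _.
apply: (@le_trans _ _ (Num.max M 0 * rnorm v)).
  by rewrite ler_wpM2r ?rnorm_ge0 // le_max lexx.
by rewrite ler_piMr // le_max lexx orbT.
Qed.

Lemma opnorm_ub x v : rnorm v <= 1 -> rnorm (x v) <= opnorm x.
Proof.
move=> v1; apply: sup_ubound; first by have [] := opnorm_has_sup x.
by exists v.
Qed.

Lemma opnorm_le x (M : R) :
  (forall v, rnorm v <= 1 -> rnorm (x v) <= M) -> opnorm x <= M.
Proof.
move=> xM; apply: ge_sup; first by have [] := opnorm_has_sup x.
by move=> _ [v /= v1 <-]; exact: xM.
Qed.

Lemma opnorm_ge0 x : 0 <= opnorm x.
Proof.
apply: le_trans (rnorm_ge0 (x 0)) _.
by apply: opnorm_ub; rewrite rnorm0.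
Qed.

Lemma opnormP x v : rnorm (x v) <= opnorm x * rnorm v.
Proof.
have [->|v0] := eqVneq v 0; first by rewrite bop0 rnorm0 mulr0.
have vp : 0 < rnorm v.
  rewrite lt_neqAle rnorm_ge0 andbT eq_sym.
  by apply: contra_neq v0 => /rnorm_eq0.
have nv : complex.Re `|(rnorm v)^-1%:C| = (rnorm v)^-1.
  by rewrite ger0_norm // ler0c invr_ge0 ltW.
have := @opnorm_ub x ((rnorm v)^-1%:C *: v).
rewrite bopZ !rnormZ nv mulVf ?gt_eqF // => /(_ (lexx _)).
by rewrite mulrC ler_pdivrMr.
Qed.

Fact opnormD x y : (opnorm (x + y))%:C <= (opnorm x)%:C + (opnorm y)%:C.
Proof.
rewrite -rmorphD /= lecR; apply: opnorm_le => v v1.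
by apply: le_trans (rnormD _ _) _; rewrite lerD // opnorm_ub.
Qed.

Fact opnormZ (l : R[i]) x : (opnorm (l *: x))%:C = `|l| * (opnorm x)%:C.
Proof.
rewrite cnormE; have := cnorm_ge0 l; have := @rnormZ _ V l.
move: (complex.Re `|l|) => c lZ c0.
rewrite -rmorphM /=; congr (_%:C); apply/eqP; rewrite eq_le; apply/andP.
split; first by apply: opnorm_le => v v1; rewrite lZ ler_wpM2l // opnorm_ub.
have [->|c_neq0] := eqVneq c 0; first by rewrite mul0r opnorm_ge0.
have cp : 0 < c by rewrite lt_neqAle eq_sym c_neq0.
rewrite mulrC -ler_pdivlMr //; apply: opnorm_le => v v1.
by rewrite ler_pdivlMr // mulrC -lZ -bopZE opnorm_ub.
Qed.

Fact opnorm_eq0 x : (opnorm x)%:C = 0 -> x = 0.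
Proof.
move=> /complexI x0; apply: bopext => v; apply: rnorm_eq0; apply/eqP.
by rewrite eq_le rnorm_ge0 andbT (le_trans (opnormP x v)) // x0 mul0r.
Qed.

HB.instance Definition _ :=
  @Lmodule_isNormed.Build R[i] bop (fun x => (opnorm x)%:C)
    opnormD opnormZ opnorm_eq0.

Lemma rnorm_bop (x : bop) : rnorm x = opnorm x.
Proof. by []. Qed.

Definition bop_invertible (x : bop) : Prop :=
  exists y : bop, y * x = 1 /\ x * y = 1.

Definition spectrum (x : bop) : set R[i] :=
  [set l : R[i] | ~ bop_invertible (l *: (1 : bop) - x)].

(* [sup set0 = 0], so the spectral radius is [0] when [V] is trivial.  This
   definition is meant for complete [V] only: if [V] is incomplete the spectrum
   in B(V) may be unbounded, and the spectral radius of an element of the normed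
   algebra B(V) is then given by the limit of [rnorm (x ^+ n) `^ n%:R^-1]. *)
Definition spectral_radius (x : bop) : R :=
  sup [set complex.Re `|l| | l in spectrum x].

End BoundedOperators.

Lemma rnorm_bopM {R : realType} {V : normedModType R[i]} (x y : bop V) :
  rnorm (x * y) <= rnorm x * rnorm y.
Proof.
rewrite !rnorm_bop; apply: opnorm_le => v v1; apply: le_trans.
  exact: (opnormP x (y v)).
by apply: ler_wpM2l; [exact: opnorm_ge0 | exact: opnorm_ub].
Qed.

(* Subalgebras of [bop E] containing the identity, not assumed closed. *)
Record subalgebra (R : realType) (E : normedModType R[i]) := Subalgebra {
  subalg_set : set (bop E) ;
  subalg1 : subalg_set 1 ;
  subalgL : forall (l : R[i]) x y,
    subalg_set x -> subalg_set y -> subalg_set (l *: x + y) ;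
  subalgM : forall x y, subalg_set x -> subalg_set y -> subalg_set (x * y) }.

(* A subalgebra [A] as a normed module for the restriction of the operator
   norm, so that [bop (subalg_type A)] is B(A). *)
Section SubalgebraType.
Variables (R : realType) (E : normedModType R[i]) (A : subalgebra E).

Record subalg_type : Type :=
  SubalgElt { subalg_val : bop E ; _ : subalg_val \in subalg_set A }.

HB.instance Definition _ := [isSub for subalg_val].
HB.instance Definition _ := [Choice of subalg_type by <:].

Lemma subalg_valP (a : subalg_type) : subalg_set A (subalg_val a).
Proof. by case: a => x /= /set_mem. Qed.

Fact subalg_submod_closed : GRing.submod_closed (fun x => x \in subalg_set A).
Proof.
have A1 := subalg1 A; split.
  by apply/mem_set; have := subalgL (-1) A1 A1; rewrite scaleN1r addNr.
by move=> l x y /set_mem Ax /set_mem Ay; apply/mem_set; exact: subalgL.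
Qed.

HB.instance Definition _ := GRing.SubChoice_isSubLmodule.Build
  R[i] (bop E) _ subalg_type subalg_submod_closed.

Fact subalg_subring_closed : GRing.subring_closed (fun x => x \in subalg_set A).
Proof.
split; first by apply/mem_set; exact: subalg1.
  move=> x y /set_mem Ax /set_mem Ay; apply/mem_set.
  by have := subalgL (-1) Ay Ax; rewrite scaleN1r addrC.
by move=> x y /set_mem Ax /set_mem Ay; apply/mem_set; exact: subalgM.
Qed.

HB.instance Definition _ := GRing.SubZmodule_isSubPzRing.Build
  (bop E) _ subalg_type subalg_subring_closed.

Let snorm (a : subalg_type) : R[i] := `|subalg_val a|.

Fact snormD a b : snorm (a + b) <= snorm a + snorm b.
Proof. exact: ler_normD. Qed.

Fact snormZ (l : R[i]) a : snorm (l *: a) = `|l| * snorm a.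
Proof. exact: normrZ. Qed.

Fact snorm_eq0 a : snorm a = 0 -> a = 0.
Proof. by move=> /normr0_eq0 a0; apply: val_inj. Qed.

HB.instance Definition _ :=
  @Lmodule_isNormed.Build R[i] subalg_type snorm snormD snormZ snorm_eq0.

End SubalgebraType.

Coercion subalg_type : subalgebra >-> Sortclass.

Definition contraction (R : realType) (E : normedModType R[i]) (T : bop E) :=
  rnorm T <= 1.

Definition mutually_adjoint_partial_isometries (R : realType)
    (E : normedModType R[i]) (T S : bop E) : Prop :=
  [/\ contraction T, contraction S, T * S * T = T & S * T * S = S].

(* The operators [a T], [a \in A], are abstract weighted shift operators, with
   the associated endomorphism [a |-> T a S]. *)
Record abstract_weighted_shift (R : realType) (E : normedModType R[i])
    (A : subalgebra E) (T S : bop E) : Prop := AbstractWeightedShift {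
  aws_adjoint : mutually_adjoint_partial_isometries T S ;
  aws_stable : forall x, subalg_set A x -> subalg_set A (T * x * S) ;
  aws_commute : forall x, subalg_set A x -> S * T * x = x * (S * T) }.

Section ShiftEndomorphism.
Variables (R : realType) (E : normedModType R[i]) (A : subalgebra E).
Variables (T S : bop E) (h : abstract_weighted_shift A T S).

Definition shift_endo (a : A) : A :=
  SubalgElt (mem_set (aws_stable h (subalg_valP a))).

Lemma shift_endoM (a b : A) : shift_endo (a * b) = shift_endo a * shift_endo b.
Proof.
have [_ _ TST _] := aws_adjoint h.
have ST := aws_commute h (subalg_valP a).
apply: val_inj; change (T * (subalg_val a * subalg_val b) * S =
  (T * subalg_val a * S) * (T * subalg_val b * S)).
by rewrite -{1}TST -!mulrA; congr (T * _); rewrite !mulrA ST !mulrA.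
Qed.

Fact weighted_endo_subproof (a : A) :
  bounded_operator (fun b : A => a * shift_endo b).
Proof.
split=> [l b c|].
  apply: val_inj; apply: bopext => v.
  by rewrite /= !bopD !bopZ.
exists (rnorm a * (rnorm T * rnorm S)) => b.
apply: (@le_trans _ _ (rnorm a * rnorm (T * subalg_val b * S))).
  exact: rnorm_bopM.
rewrite -[leRHS]mulrA; apply: ler_wpM2l; first exact: rnorm_ge0.
apply: le_trans (rnorm_bopM _ _) _; rewrite [leRHS]mulrAC.
by apply: ler_wpM2r; [exact: rnorm_ge0 | exact: rnorm_bopM].
Qed.

(* The weighted endomorphism a alpha, as an element of B(A). *)
Definition weighted_endo (a : A) : bop A := mkbop (weighted_endo_subproof a).

End ShiftEndomorphism.

(* Main.v *)
(* Writing P_n = a alpha(a) ... alpha^(n-1)(a), the relation T b = alpha(b) T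
   gives (a T)^n = P_n T^n, P_(n+1) = (a T)^n a S^n and
   (a alpha)^n b = P_n alpha^n(b).  As T, S and alpha are contractions, the
   norms of (a T)^n, P_n and (a alpha)^n have the same exponential growth rate,
   and alpha(a) T = T a has the same spectral radius as a T.  What remains is
   the formula r(x) = lim |x^n|^(1/n), which is proved without holomorphic
   functions (after Rickart): the average over the n-th roots of unity om of
   (1 - om s x)^-1 is (1 - s^n x^n)^-1, and on a disc where the resolvent
   exists it is bounded by compactness, so that these averages are
   equicontinuous in s, uniformly in n.  Hence if s^n x^n -> 0, then s'^n x^n is
   bounded for all s' in the disc with s' <= s + d, where d is independent of
   s, and finitely many such steps reach the boundary of the disc. *)
Require Import Defs.
From mathcomp Require Import ring lra.

Import Order.TTheory GRing.Theory Num.Theory.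
Import numFieldNormedType.Exports.

Local Open Scope classical_set_scope.
Local Open Scope complex_scope.
Local Open Scope ring_scope.

(** * Exponential growth rates of real sequences *)

(* The constants make this insensitive to shifts of the index. *)
Definition growth_rate {R : realType} (u : nat -> R) (r : R) : Prop :=
  [/\ 0 <= r, forall n, 0 <= u n,
      exists2 c, 0 < c & \forall n \near \oo, c * r ^+ n <= u n &
      forall s, r < s -> exists C, \forall n \near \oo, u n <= C * s ^+ n].

Lemma cvg_powR_invn {R : realType} (c : R) : 0 < c ->
  c `^ n%:R^-1 @[n --> \oo] --> (1 : R).
Proof.
move=> c0.
have -> : (fun n => c `^ n%:R^-1) = expR \o (fun n => n%:R^-1 * ln c).
  by apply/funext => n; rewrite /powR gt_eqF.
have inv0 : (n%:R^-1 : R) @[n --> \oo] --> (0 : R).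
  apply/gtr0_cvgV0; last exact: cvgr_idn.
  by near=> n; rewrite ltr0n; near: n; exact: nbhs_infty_gt.
have inv0c : n%:R^-1 * ln c @[n --> \oo] --> (0 : R).
  by rewrite -(mul0r (ln c)); exact: cvgMr_tmp.
by have := cvg_comp _ _ inv0c (@continuous_expR R 0); rewrite expR0.
Unshelve. all: by end_near. Qed.

Lemma powR_exprn_invn {R : realType} (s : R) (n : nat) : (0 < n)%N -> 0 <= s ->
  (s ^+ n) `^ n%:R^-1 = s.
Proof.
move=> n0 s0; rewrite -powR_mulrn // -powRrM mulfV ?powRr1 //.
by rewrite pnatr_eq0 -lt0n.
Qed.

(** After taking [n]-th roots the constants of both bounds tend to 1. The upper bound is used at
    [r + e / 2], which leaves another [e / 2] to absorb the root of its constant. *)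
Lemma growth_rate_cvg {R : realType} (u : nat -> R) (r : R) :
  growth_rate u r -> u n `^ n%:R^-1 @[n --> \oo] --> r.
Proof.
move=> [r0 u0 [c c0 cu] ub]; apply/cvgrPdist_le => e e0.
have [C Cu] : exists C, \forall n \near \oo, u n <= C * (r + e / 2) ^+ n.
  by apply: ub; rewrite ltrDl divr_gt0.
have s0 : 0 <= r + e / 2 by rewrite addr_ge0 // divr_ge0 // ltW.
(* [C] need not be positive, and only roots of a positive constant tend to 1. *)
have C0 : 0 < Num.max C 1 by rewrite lt_max ltr01 orbT.
have lb : \forall n \near \oo, r - e <= c `^ n%:R^-1 * r.
  have : c `^ n%:R^-1 * r @[n --> \oo] --> 1 * r.
    by apply: cvgMr_tmp; exact: cvg_powR_invn.
  by rewrite mul1r => /cvgr_ge; apply; rewrite ltrBlDr ltrDl.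
have lub : \forall n \near \oo, Num.max C 1 `^ n%:R^-1 * (r + e / 2) <= r + e.
  have : Num.max C 1 `^ n%:R^-1 * (r + e / 2) @[n --> \oo] --> 1 * (r + e / 2).
    apply: cvgMr_tmp; exact: cvg_powR_invn.
  rewrite mul1r => /cvgr_le; apply.
  by rewrite ltrD2l ltr_pdivrMr // ltr_pMr // ltr1n.
near=> n.
have n0 : (0 < n)%N by near: n; exact: nbhs_infty_gt.
have rnn : 0 <= n%:R^-1 :> R by rewrite invr_ge0.
rewrite distrC ler_distl; apply/andP; split.
- apply: le_trans (_ : c `^ n%:R^-1 * r <= _); first by near: n.
  rewrite -{1}(powR_exprn_invn r n n0 r0) -powRM ?exprn_ge0 // ?(ltW c0) //.
  apply: ge0_ler_powR; rewrite ?nnegrE ?mulr_ge0 ?exprn_ge0 // ?(ltW c0) //.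
  by near: n.
- apply: le_trans (_ : Num.max C 1 `^ n%:R^-1 * (r + e / 2) <= _); last by near: n.
  rewrite -{1}(powR_exprn_invn _ n n0 s0) -powRM ?exprn_ge0 // ?(ltW C0) //.
  apply: ge0_ler_powR; rewrite ?nnegrE ?mulr_ge0 ?exprn_ge0 // ?(ltW C0) //.
  apply: le_trans (_ : C * (r + e / 2) ^+ n <= _); first by near: n.
  by rewrite ler_wpM2r ?exprn_ge0 // le_max lexx.
Unshelve. all: by end_near. Qed.

(** Each comparison shifts the index by one; this costs a factor [r] or [s], which is absorbed into
    the constants. *)
Lemma growth_rate_transfer {R : realType} (u v : nat -> R) (r C : R) :
    (forall n, 0 <= v n) ->
    (forall n, u n.+1 <= C * v n) -> (forall n, v n.+1 <= C * u n) ->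
  growth_rate u r -> growth_rate v r.
Proof.
move=> v0 uv vu [r0 u0 [c c0 cu] ub].
pose D := Num.max C 1; have D0 : 0 < D by rewrite lt_max ltr01 orbT.
have CD : C <= D by rewrite le_max lexx.
split=> //.
(* For [r = 0] the constant [c * r / D] used below would vanish, but then the lower bound is
   trivial, as [0 ^+ n = 0] for [n > 0]. *)
- have [->|rn0] := eqVneq r 0.
    exists 1 => //; near=> n; rewrite mul1r expr0n gtn_eqF //.
    by near: n; exact: nbhs_infty_gt.
  have rp : 0 < r by rewrite lt_def rn0.
  exists (c * r / D); first by rewrite divr_gt0 ?mulr_gt0.
  have [N _ cuN] := cu; near=> n.
  rewrite mulrAC ler_pdivrMr // -mulrA -exprS [leRHS]mulrC.
  apply: le_trans (cuN n.+1 _) (le_trans (uv n) _); last by rewrite ler_wpM2r.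
  by rewrite /=; apply: leqW; near: n; exact: nbhs_infty_ge.
- move=> s rs; have [K [N _ uK]] := ub s rs; exists (D * K / s).
  have s0 : 0 < s by exact: le_lt_trans rs.
  exists N.+1 => // -[//|n] /= Nn; apply: le_trans (vu n) _.
  apply: le_trans (_ : D * u n <= _); first by rewrite ler_wpM2r.
  rewrite exprS -!mulrA ler_wpM2l ?(ltW D0) // mulKf ?gt_eqF //.
  exact: uK.
Unshelve. all: by end_near. Qed.

(** * Sequential completeness *)

Lemma rnormN {R : realType} {V : normedModType R[i]} (x : V) :
  rnorm (- x) = rnorm x.
Proof. by rewrite /rnorm normrN. Qed.

Lemma rnormBC {R : realType} {V : normedModType R[i]} (x y : V) :
  rnorm (x - y) = rnorm (y - x).
Proof. by rewrite -rnormN opprB. Qed.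

Lemma rnormB {R : realType} {V : normedModType R[i]} (x y : V) :
  rnorm (x - y) <= rnorm x + rnorm y.
Proof. by rewrite -[rnorm y]rnormN; exact: rnormD. Qed.

Lemma rnorm_distD {R : realType} {V : normedModType R[i]} (x y z : V) :
  rnorm (y - z) <= rnorm (x - y) + rnorm (x - z).
Proof. by rewrite (rnormBC x y) -[y - z](subrKA x) rnormD. Qed.

Lemma rnorm_sum {R : realType} {V : normedModType R[i]} (I : Type) (s : seq I)
    (P : pred I) (f : I -> V) :
  rnorm (\sum_(i <- s | P i) f i) <= \sum_(i <- s | P i) rnorm (f i).
Proof.
elim/big_ind2: _ => [|x1 x2 y1 y2 h1 h2|//]; first by rewrite rnorm0.
by apply: le_trans (rnormD _ _) _; exact: lerD.
Qed.

Lemma rnorm_le_eps0 {R : realType} {V : normedModType R[i]} (x : V) :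
  (forall e, 0 < e -> rnorm x <= e) -> x = 0.
Proof.
move=> xe; apply: rnorm_eq0; apply/eqP; rewrite eq_le rnorm_ge0 andbT.
by apply/ler_addgt0Pr => e /xe; rewrite add0r.
Qed.

Definition rcvg {R : realType} {V : normedModType R[i]} (u : nat -> V) (l : V) :=
  forall e : R, 0 < e ->
    exists N, forall n, (N <= n)%N -> rnorm (u n - l) <= e.

Definition rcauchy {R : realType} {V : normedModType R[i]} (u : nat -> V) :=
  forall e : R, 0 < e ->
    exists N, forall n m, (N <= n)%N -> (N <= m)%N -> rnorm (u n - u m) <= e.

(** Completeness as a property rather than a structure, so that it can be passed on from [E] to
    [bop E] and to a closed [A]. *)
Definition seq_complete {R : realType} (V : normedModType R[i]) :=
  forall u : nat -> V, rcauchy u -> exists l, rcvg u l.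

Lemma rcvg_dist_le {R : realType} {V : normedModType R[i]} (u : nat -> V)
    (l w : V) (c : R) (N : nat) :
  rcvg u l -> (forall n, (N <= n)%N -> rnorm (u n - w) <= c) -> rnorm (l - w) <= c.
Proof.
move=> ul uw; apply/ler_addgt0Pr => e /ul[M uM].
rewrite [leRHS]addrC; apply: le_trans (rnorm_distD (u (maxn M N)) l w) _.
by apply: lerD; [apply: uM|apply: uw]; rewrite ?leq_maxl ?leq_maxr.
Qed.

Lemma rcvg_cvg {R : realType} {V : normedModType R[i]} (u : nat -> V) (l : V) :
  rcvg u l <-> u n @[n --> \oo] --> l.
Proof.
split=> [ul|/cvgrPdist_le ul e e0].
- apply/cvgrPdist_le => e e0.
  have eE : e = (complex.Re e)%:C by apply/esym/RRe_real/gtr0_real.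
  have {}e0 : 0 < complex.Re e by rewrite -ltcR -eE.
  have [N uN] := ul _ e0; exists N => // n /= Nn.
  by rewrite eE rnormE lecR rnormBC; exact: uN.
- have [|N _ uN] := ul e%:C; first by rewrite ltcR.
  by exists N => n Nn; have := uN n Nn; rewrite /= rnormE lecR rnormBC.
Qed.

Lemma completeNormedMod_seq_complete {R : realType}
    (V : completeNormedModType R[i]) : seq_complete V.
Proof.
move=> u uc; have : cauchy (u n @[n --> \oo]).
  apply/cauchy_ballP => e e0.
  have eE : e = (complex.Re e)%:C by apply/esym/RRe_real/gtr0_real.
  have {}e0 : 0 < complex.Re e by rewrite -ltcR -eE.
  have [|N uN] := uc (complex.Re e / 2); first by rewrite divr_gt0.
  exists ([set u n | n in [set n | (N <= n)%N]],
          [set u n | n in [set n | (N <= n)%N]]).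
    by split; exists N => //= n Nn; exists n.
  move=> [_ _] [/= [n Nn <-] [m Nm <-]]; rewrite -ball_normE /= eE rnormE ltcR.
  apply: le_lt_trans (uN _ _ Nn Nm) _.
  by rewrite ltr_pdivrMr // ltr_pMr ?ltr1n.
by move=> /cauchy_cvg/cvg_ex[l ul]; exists l; apply/rcvg_cvg.
Qed.

(** The pointwise limit is the candidate. It is bounded because the sequence is eventually within 1
    of a fixed [u N], and the convergence is uniform on the unit ball because the Cauchy estimate
    survives letting one index tend to infinity. *)
Lemma bop_seq_complete {R : realType} (V : normedModType R[i]) :
  seq_complete V -> seq_complete (bop V).
Proof.
move=> cV u uc.
have /choice[f fP] : forall v, exists l, rcvg (fun n => u n v) l.
  move=> v; apply: cV => e e0.
  have v0 : 0 < rnorm v + 1 by rewrite ltr_wpDl ?rnorm_ge0.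
  have [|N uN] := uc (e / (rnorm v + 1)); first by rewrite divr_gt0.
  exists N => n m Nn Nm; apply: le_trans (opnormP (u n - u m) v) _.
  rewrite -rnorm_bop; apply: le_trans (_ : _ <= e / (rnorm v + 1) * rnorm v) _.
    by rewrite ler_wpM2r ?rnorm_ge0 // uN.
  by rewrite mulrAC ler_pdivrMr // ler_wpM2l ?(ltW e0) // lerDl.
have fb : bounded_operator f.
  split=> [l v w|].
  - apply/eqP; rewrite -subr_eq0; apply/eqP/rnorm_le_eps0 => e e0.
    have e3 : 0 < e / 3 by rewrite divr_gt0.
    have l0 : 0 < complex.Re `|l| + 1 by rewrite ltr_wpDl ?cnorm_ge0.
    have [N1 h1] := fP (l *: v + w) _ e3.
    have [|N2 h2] := fP v (e / 3 / (complex.Re `|l| + 1)).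
      by rewrite divr_gt0.
    have [N3 h3] := fP w _ e3.
    set n := maxn N1 (maxn N2 N3).
    have {}h1 := h1 n (leq_maxl _ _).
    have {}h2 := h2 n (leq_trans (leq_maxl _ _) (leq_maxr _ _)).
    have {}h3 := h3 n (leq_trans (leq_maxr _ _) (leq_maxr _ _)).
    apply: le_trans (rnorm_distD (u n (l *: v + w)) _ _) _.
    have -> : e = e / 3 + (e / 3 + e / 3) by field.
    apply: lerD => //; rewrite bopD bopZ.
    rewrite (_ : _ - _ = l *: (u n v - f v) + (u n w - f w)); last first.
      by rewrite scalerBr opprD addrACA.
    apply: le_trans (rnormD _ _) _; apply: lerD => //; rewrite rnormZ.
    apply: le_trans (_ : (complex.Re `|l| + 1) * rnorm (u n v - f v) <= _).
      by rewrite ler_wpM2r ?rnorm_ge0 // lerDl.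
    by rewrite mulrC -ler_pdivlMr.
  - have [|N uN] := uc 1; first exact: ltr01.
    exists (rnorm (u N) + 1) => v; rewrite -[f v]subr0.
    apply: (@rcvg_dist_le _ _ (fun n => u n v) _ _ _ N) => [|n Nn]; first exact: fP.
    rewrite subr0 -[u n v](subrK (u N v)) mulrDl mul1r addrC.
    apply: le_trans (rnormD _ _) _; apply: lerD; first exact: opnormP.
    apply: le_trans (opnormP (u n - u N) v) _.
    by rewrite ler_piMl ?rnorm_ge0 // -rnorm_bop uN.
exists (mkbop fb) => e e0; have [N uN] := uc e e0.
exists N => n Nn; rewrite rnorm_bop; apply: opnorm_le => v v1.
rewrite rnormBC; apply: (@rcvg_dist_le _ _ (fun n => u n v) _ _ _ N) => [|m Nm].
  exact: fP.
apply: le_trans (opnorm_ub (u m - u n) v1) _.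
by rewrite -rnorm_bop uN.
Qed.

Lemma subalgebra_seq_complete {R : realType} {E : normedModType R[i]}
    (A : subalgebra E) :
  seq_complete E -> closed (subalg_set A) -> seq_complete A.
Proof.
move=> cE clA u uc.
have [l ul] : exists l, rcvg (fun n => subalg_val (u n)) l.
  exact: (bop_seq_complete _ cE).
have Al : subalg_set A l.
  apply: (closed_cvg _ clA) ((rcvg_cvg _ _).1 ul).
  by near=> n; exact: subalg_valP.
by exists (SubalgElt (mem_set Al)).
Unshelve. all: by end_near. Qed.

(** * Invertibility and the spectrum *)

Lemma mul_sub1_sumX {A : pzRingType} (w : A) n :
  (1 - w) * (\sum_(i < n) w ^+ i) = 1 - w ^+ n.
Proof. by rewrite -[1 - w]opprB mulNr -subrX1 opprB. Qed.

Lemma sumX_mul_sub1 {A : pzRingType} (w : A) n :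
  (\sum_(i < n) w ^+ i) * (1 - w) = 1 - w ^+ n.
Proof.
rewrite -mul_sub1_sumX mulr_sumr mulr_suml; apply: eq_bigr => i _.
by rewrite mulrBr mulrBl mulr1 mul1r -exprS -exprSr.
Qed.

Section BopAlgebra.
Context {R : realType} {V : normedModType R[i]}.
Implicit Types x y w : bop V.

Lemma bopZl (l : R[i]) x y : (l *: x) * y = l *: (x * y).
Proof. exact: bopext. Qed.

Lemma bopZr (l : R[i]) x y : x * (l *: y) = l *: (x * y).
Proof. by apply: bopext => v; exact: bopZ. Qed.

Lemma bopZX (l : R[i]) x n : (l *: x) ^+ n = l ^+ n *: x ^+ n.
Proof.
elim: n => [|n IH]; first by rewrite !expr0 scale1r.
by rewrite !exprS IH bopZl bopZr scalerA.
Qed.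

Lemma rnorm_bop1 : rnorm (1 : bop V) <= 1.
Proof. by rewrite rnorm_bop; apply: opnorm_le. Qed.

Lemma rnorm_bopX x n : rnorm (x ^+ n) <= rnorm x ^+ n.
Proof.
elim: n => [|n IH]; first by rewrite !expr0 rnorm_bop1.
by rewrite !exprS; apply: le_trans (rnorm_bopM _ _) _; rewrite ler_wpM2l ?rnorm_ge0.
Qed.

(** Take norms in [y = 1 + y * w]. *)
Lemma rnorm_left_inverse y w : y * (1 - w) = 1 -> rnorm y * (1 - rnorm w) <= 1.
Proof.
move=> yw; have yE : y = 1 + y * w by rewrite -yw mulrBr mulr1 subrK.
rewrite mulrBr mulr1 lerBlDr {1}yE; apply: le_trans (rnormD _ _) _.
by apply: lerD; [exact: rnorm_bop1|exact: rnorm_bopM].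
Qed.

(** The inverse is the limit of the geometric sums [s n], whose product with [1 - w] on either side
    telescopes to [1 - w ^+ n]. *)
Lemma neumann w : seq_complete V -> rnorm w < 1 ->
  exists y, y * (1 - w) = 1 /\ (1 - w) * y = 1.
Proof.
move=> cV w1; pose s n := \sum_(i < n) w ^+ i.
have q0 : 0 < 1 - rnorm w by rewrite subr_gt0.
have sl n : (1 - w) * s n = 1 - w ^+ n by exact: mul_sub1_sumX.
have sr n : s n * (1 - w) = 1 - w ^+ n by exact: sumX_mul_sub1.
have geo (e : R) : 0 < e -> exists N, forall n, (N <= n)%N -> rnorm (w ^+ n) <= e.
  move=> e0; have /cvgr_le : rnorm w ^+ n @[n --> \oo] --> 0.
    by apply: cvg_expr; rewrite ger0_norm ?rnorm_ge0.
  move=> /(_ _ e0)[N _ h]; exists N => n Nn.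
  by apply: le_trans (rnorm_bopX _ _) _; exact: h.
have [y sy] : exists y, rcvg s y.
  apply: (bop_seq_complete _ cV) => e e0.
  have [|N h] := geo (e * (1 - rnorm w) / 2); first by rewrite divr_gt0 ?mulr_gt0.
  exists N => n m Nn Nm; rewrite -(ler_pM2r q0).
  (* d = w d + (w^m - w^n) bounds d = s n - s m without summing a series. *)
  have E : s n - s m = w * (s n - s m) + (w ^+ m - w ^+ n).
    have -> : w ^+ m - w ^+ n = (1 - w) * (s n - s m).
      by rewrite mulrBr !sl opprB [RHS]addrC subrKA.
    by rewrite mulrBl mul1r [RHS]addrC subrK.
  have dn : rnorm (s n - s m) <= rnorm w * rnorm (s n - s m)
      + (e * (1 - rnorm w) / 2 + e * (1 - rnorm w) / 2).
    rewrite {1}E; apply: le_trans (rnormD _ _) _; apply: lerD.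
      exact: rnorm_bopM.
    by apply: le_trans (rnormB _ _) _; rewrite lerD ?h.
  move: dn; rewrite -splitr; move: (rnorm _) (rnorm w) => *; lra.
(* Serves both orders of multiplication: [z n] is [s n * (1 - w)] or [(1 - w) * s n], and [t] is the
   same product with [y] in place of [s n]. *)
have lim (z : nat -> bop V) (t : bop V) (C : R) : (forall n, z n = 1 - w ^+ n) ->
    (forall n, rnorm (z n - t) <= C * rnorm (s n - y)) -> t = 1.
  move=> zE zt; apply/eqP; rewrite -subr_eq0; apply/eqP/rnorm_le_eps0 => e e0.
  have D0 : 0 < Num.max C 1 by rewrite lt_max ltr01 orbT.
  have [|N1 h1] := geo (e / 2); first by rewrite divr_gt0.
  have [|N2 h2] := sy (e / 2 / Num.max C 1); first by rewrite !divr_gt0.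
  set n := maxn N1 N2; apply: le_trans (rnorm_distD (z n) _ _) _.
  rewrite [leRHS]splitr; apply: lerD; last first.
    by rewrite zE addrAC subrr add0r rnormN h1 // leq_maxl.
  apply: le_trans (zt n) _; apply: le_trans (_ : Num.max C 1 * rnorm (s n - y) <= _).
    by rewrite ler_wpM2r ?rnorm_ge0 // le_max lexx.
  by rewrite mulrC -ler_pdivlMr // h2 // leq_maxr.
exists y; split.
- apply: (lim _ _ (rnorm (1 - w)) sr) => n.
  by rewrite -mulrBl [leRHS]mulrC; exact: rnorm_bopM.
- apply: (lim _ _ (rnorm (1 - w)) sl) => n.
  by rewrite -mulrBr; exact: rnorm_bopM.
Qed.

(** With the geometric sum [s], [y * s] is a left inverse of [1 - w] and [s * y] a right inverse, so
    the two coincide. *)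
Lemma bop_invertible_sub1X w n :
  bop_invertible (1 - w ^+ n) -> bop_invertible (1 - w).
Proof.
move=> [y [yw wy]]; pose s := \sum_(i < n) w ^+ i.
have L : y * s * (1 - w) = 1 by rewrite -mulrA sumX_mul_sub1.
have Rt : (1 - w) * (s * y) = 1 by rewrite mulrA mul_sub1_sumX.
exists (s * y); split=> //.
have -> : s * y = y * s by rewrite -[s * y]mul1r -L -(mulrA (y * s)) Rt mulr1.
exact: L.
Qed.

Lemma bop_invertibleZ (l : R[i]) x :
  l != 0 -> bop_invertible (1 - l^-1 *: x) -> bop_invertible (l *: (1 : bop V) - x).
Proof.
move=> l0 [y [yl ly]].
have E : l *: (1 : bop V) - x = l *: (1 - l^-1 *: x).
  by rewrite scalerBr scalerA mulfV // scale1r.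
exists (l^-1 *: y).
by rewrite E !bopZl !bopZr !scalerA yl ly mulVf ?mulfV // scale1r.
Qed.

Lemma bop_invertible_resolvent (l : R[i]) x :
  bop_invertible (l *: (1 : bop V) - x) -> l != 0 -> bop_invertible (1 - l^-1 *: x).
Proof.
move=> [y [yl ly]] l0.
have E : 1 - l^-1 *: x = l^-1 *: (l *: (1 : bop V) - x).
  by rewrite scalerBr scalerA mulVf // scale1r.
exists (l *: y).
by rewrite E !bopZl !bopZr !scalerA yl ly mulVf ?mulfV // scale1r.
Qed.

End BopAlgebra.

Section Spectrum.
Context {R : realType} {V : normedModType R[i]} (x : bop V).
Hypothesis cV : seq_complete V.

(** Otherwise [(l^-1 *: x) ^+ n] has norm below 1, so [1 - (l^-1 *: x) ^+ n] is invertible by the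
    Neumann series, and with it its factor [1 - l^-1 *: x]. *)
Lemma spectrum_norm_le_exp (l : R[i]) n : (0 < n)%N -> spectrum x l ->
  complex.Re `|l| ^+ n <= rnorm (x ^+ n).
Proof.
move=> n0 lx; rewrite leNgt; apply/negP => xl; apply: lx.
have lp : 0 < complex.Re `|l|.
  rewrite lt_def cnorm_ge0 andbT; apply/eqP => l0.
  by move: xl; rewrite l0 expr0n gtn_eqF // ltNge rnorm_ge0.
have l0 : l != 0 by apply: contraTneq lp => ->; rewrite normr0 ltxx.
apply: bop_invertibleZ => //; apply: (@bop_invertible_sub1X _ _ _ n).
rewrite bopZX; apply: neumann => //; rewrite rnormZ.
have -> : complex.Re `|l^-1 ^+ n| = (complex.Re `|l| ^+ n)^-1.
  apply: complexI; rewrite -cnormE normrX normfV exprVn.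
  by rewrite fmorphV rmorphXn /= -cnormE.
by rewrite mulrC ltr_pdivrMr ?exprn_gt0 // mul1r.
Qed.

Lemma spectrum_ubound : ubound [set complex.Re `|l| | l in spectrum x] (rnorm x).
Proof.
move=> _ [l lx <-]; have := @spectrum_norm_le_exp l 1 isT lx.
by rewrite !expr1.
Qed.

Lemma spectrum_le_radius (l : R[i]) :
  spectrum x l -> complex.Re `|l| <= spectral_radius x.
Proof.
move=> lx; apply: sup_ubound; last by exists l.
by exists (rnorm x); exact: spectrum_ubound.
Qed.

Lemma spectral_radius_le (t : R) : 0 <= t ->
  (forall l, spectrum x l -> complex.Re `|l| <= t) -> spectral_radius x <= t.
Proof.
(* If the spectrum is empty, the supremum takes its default value 0, and [t0] applies. *)
move=> t0 xt; have [[l lx]|ne] := pselect (exists l, spectrum x l).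
  apply: ge_sup; first by exists (complex.Re `|l|), l.
  by move=> _ [{lx}l lx <-]; exact: xt.
rewrite /spectral_radius (_ : [set _ | _ in _] = set0) ?sup0 //.
by apply/seteqP; split=> // s [l lx _]; apply: ne; exists l.
Qed.

Lemma spectral_radius_ge0 : 0 <= spectral_radius x.
Proof.
have [[l lx]|ne] := pselect (exists l, spectrum x l).
  exact: le_trans (cnorm_ge0 l) (spectrum_le_radius _ lx).
rewrite /spectral_radius (_ : [set _ | _ in _] = set0) ?sup0 //.
by apply/seteqP; split=> // s [l lx _]; apply: ne; exists l.
Qed.

Lemma spectral_radius_exp_le n : (0 < n)%N ->
  spectral_radius x ^+ n <= rnorm (x ^+ n).
Proof.
move=> n0.
have t0 : 0 <= rnorm (x ^+ n) `^ n%:R^-1 by exact: powR_ge0.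
have -> : rnorm (x ^+ n) = (rnorm (x ^+ n) `^ n%:R^-1) ^+ n.
  by rewrite -powR_mulrn // -powRrM mulVf ?powRr1 ?rnorm_ge0 // pnatr_eq0 -lt0n.
rewrite lerXn2r ?nnegrE ?spectral_radius_ge0 //.
apply: spectral_radius_le => // l lx.
rewrite -[leLHS](powR_exprn_invn _ n) ?cnorm_ge0 //.
apply: ge0_ler_powR; rewrite ?nnegrE ?exprn_ge0 ?cnorm_ge0 ?rnorm_ge0 ?invr_ge0 //.
exact: spectrum_norm_le_exp.
Qed.

(** For [mu != 0], failure of invertibility puts [mu^-1] into the spectrum, which forces
    [1 <= m * spectral_radius x]. *)
Lemma resolvent_exists (m : R) (mu : R[i]) : m * spectral_radius x < 1 ->
  complex.Re `|mu| <= m -> bop_invertible (1 - mu *: x).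
Proof.
move=> mr mum; have [->|mu0] := eqVneq mu 0.
  by rewrite scale0r subr0; exists 1; rewrite mulr1.
rewrite -[mu]invrK; apply: bop_invertible_resolvent; last by rewrite invr_eq0.
apply: contrapT => nx.
have := spectrum_le_radius _ nx.
have -> : complex.Re `|mu^-1| = (complex.Re `|mu|)^-1.
  by apply: complexI; rewrite -cnormE normfV fmorphV /= -cnormE.
have mup : 0 < complex.Re `|mu| by rewrite -ltcR -cnormE normr_gt0.
apply/negP; rewrite -ltNge -(ltr_pM2l mup) mulfV ?gt_eqF //.
by apply: le_lt_trans mr; rewrite ler_wpM2r ?spectral_radius_ge0.
Qed.

End Spectrum.

(** * The resolvent on a disc *)

Section UnitCircle.
Context {R : realType}.
Implicit Types t : R.

Definition cis t : R[i] := cos t +i* sin t.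

Lemma cisD s t : cis (s + t) = cis s * cis t.
Proof. by rewrite /cis cosD sinD; simpc; rewrite [sin s * _ + _]addrC. Qed.

Lemma cis0 : cis 0 = 1.
Proof. by rewrite /cis cos0 sin0. Qed.

Lemma cisX t n : cis t ^+ n = cis (t *+ n).
Proof.
elim: n => [|n IH]; first by rewrite expr0 mulr0n cis0.
by rewrite exprS IH mulrS cisD.
Qed.

Lemma norm_cis t : `|cis t| = 1.
Proof. by rewrite normc_def /= cos2Dsin2 sqrtr1. Qed.

Lemma cis_neq1 t : 0 < t < pi *+ 2 -> cis t != 1.
Proof.
move=> /andP[t0 t2]; apply/eqP => -[ct _].
have : 0 < sin (t / 2).
  apply: sin_gt0_pi; rewrite divr_gt0 //= ltr_pdivrMr //.
  by rewrite mulr_natr.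
move: ct; rewrite -{1}[t](@divfK _ 2) // mulr_natr cos_mulr2n cos2sin2 => ct.
have /eqP : sin (t / 2) ^+ 2 = 0 by move: ct; lra.
by rewrite expf_eq0 /= => /eqP ->; rewrite ltxx.
Qed.

(** A geometric sum whose ratio [cis t] differs from 1 while its [n]-th power is 1. *)
Lemma sum_cisX n k : (0 < k < n)%N ->
  \sum_(j < n) cis (pi *+ 2 / n%:R *+ j) ^+ k = 0.
Proof.
move=> /andP[k0 kn]; have n0 : (0 : R) < n%:R by rewrite ltr0n (leq_trans _ kn).
set t : R := pi *+ 2 / n%:R *+ k.
have tn1 : cis t != 1.
  have pi2 : 0 < (pi *+ 2 : R) by rewrite pmulrn_rgt0 ?pi_gt0.
  apply: cis_neq1; rewrite /t -mulr_natr.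
  rewrite mulr_gt0 ?divr_gt0 ?ltr0n ?(leq_ltn_trans _ kn) //=.
  by rewrite mulrAC ltr_pdivrMr // ltr_pM2l // ltr_nat.
rewrite (eq_bigr (fun j : 'I_n => cis t ^+ j)); last first.
  by move=> j _; rewrite !cisX -!mulrnA mulnC.
have /mulfI : cis t - 1 != 0 by rewrite subr_eq0.
apply; rewrite -subrX1 mulr0.
rewrite cisX /t -mulrnA mulnC mulrnA -(mulr_natr (_ / _)) divfK ?gt_eqF //.
by rewrite -cisX /cis cos2pi sin2pi expr1n subrr.
Qed.

Lemma normc_le_Re_Im (z : R[i]) :
  complex.Re `|z| <= `|complex.Re z| + `|complex.Im z|.
Proof.
rewrite -[leRHS]ger0_norm ?addr_ge0 // -sqrtr_sqr normc_def /= ler_wsqrtr //.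
rewrite sqrrD !real_normK ?num_real // -addrA lerD2l lerDr.
by rewrite mulrn_wge0 ?mulr_ge0.
Qed.

End UnitCircle.

(** * Bounds and averages of the resolvent *)

Section Resolvent.
Context {R : realType} {V : normedModType R[i]} (x : bop V).
Hypothesis cV : seq_complete V.

(** [1 - nu *: x] factors as [(1 - mu *: x) * (1 - w)] with [rnorm w <= 2^-1], and the Neumann
    inverse of [1 - w] has norm at most 2. *)
Lemma resolvent_perturb (mu nu : R[i]) (y : bop V) :
    y * (1 - mu *: x) = 1 -> (1 - mu *: x) * y = 1 ->
    complex.Re `|nu - mu| * (rnorm y * rnorm x) <= 2^-1 ->
  exists z, [/\ z * (1 - nu *: x) = 1, (1 - nu *: x) * z = 1 &
    rnorm z <= 2 * rnorm y].
Proof.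
move=> yl yr d2; pose w := (nu - mu) *: (y * x).
have w2 : rnorm w <= 2^-1.
  rewrite /w rnormZ; apply: le_trans d2; rewrite ler_wpM2l ?cnorm_ge0 //.
  exact: rnorm_bopM.
have [|z [zl zr]] := neumann w cV; first by apply: le_lt_trans w2 _; lra.
have z2 : rnorm z <= 2.
  have := rnorm_left_inverse _ _ zl; have := rnorm_ge0 z.
  by move: w2; move: (rnorm w) (rnorm z) => a b; nra.
have E : 1 - nu *: x = (1 - mu *: x) * (1 - w).
  rewrite mulrBr mulr1 /w bopZr mulrA yr mul1r scalerBl opprB.
  by rewrite addrA subrK.
exists (z * y); rewrite E; split.
- by rewrite mulrA -(mulrA z) yl mulr1.
- by rewrite mulrA -(mulrA _ (1 - w)) zr mulr1.
- by apply: le_trans (rnorm_bopM _ _) _; rewrite ler_wpM2r ?rnorm_ge0.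
Qed.

(** In polar coordinates the disc is the image of a compact rectangle. [resolvent_perturb] bounds
    the inverses near each point, and compactness makes the bound uniform. *)
Lemma resolvent_bounded (m : R) :
    (forall mu : R[i], complex.Re `|mu| <= m -> bop_invertible (1 - mu *: x)) ->
  exists M, forall s t, 0 <= s <= m -> 0 <= t <= pi *+ 2 ->
    exists y, [/\ y * (1 - (s%:C * cis t) *: x) = 1,
      (1 - (s%:C * cis t) *: x) * y = 1 & rnorm y <= M].
Proof.
move=> inv.
pose K : set (R * R) := `[0, m] `*` `[0, pi *+ 2].
pose mu (z : R * R) : R[i] := z.1%:C * cis z.2.
pose P (M : R) (z : R * R) := exists y, [/\ y * (1 - mu z *: x) = 1,
  (1 - mu z *: x) * y = 1 & rnorm y <= M].
have cK : compact K by apply: compact_setX; exact: segment_compact.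
have muRe z : complex.Re (mu z) = z.1 * cos z.2 by rewrite /mu /cis; simpc.
have muIm z : complex.Im (mu z) = z.1 * sin z.2 by rewrite /mu /cis; simpc.
have [M [_ KM]] : \forall M \near +oo, K `<=` P M.
  move/compact_near_coveringP: cK; apply => z0 [z01 _].
  have [y [yl yr]] : bop_invertible (1 - mu z0 *: x).
    move: z01; rewrite /= in_itv /= => /andP[a b].
    by apply: inv; rewrite /mu normrM norm_cis mulr1 ger0_norm ?ler0c.
  (* The [+ 1] makes [c] positive. The distance [2^-1 / c] that [resolvent_perturb] tolerates is
     shared equally between real and imaginary parts. *)
  pose c := rnorm y * rnorm x + 1.
  have c0 : 0 < c by rewrite ltr_wpDl ?mulr_ge0 ?rnorm_ge0.
  have e0 : 0 < 2^-1 / c / 2 by rewrite !divr_gt0.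
  have cRe : (fun z : R * R => z.1 * cos z.2) z @[z --> z0] --> z0.1 * cos z0.2.
    apply: cvgM; first exact: cvg_fst.
    by apply: cvg_comp; [exact: cvg_snd|exact: continuous_cos].
  have cIm : (fun z : R * R => z.1 * sin z.2) z @[z --> z0] --> z0.1 * sin z0.2.
    apply: cvgM; first exact: cvg_fst.
    by apply: cvg_comp; [exact: cvg_snd|exact: continuous_sin].
  move/cvgrPdist_le/(_ _ e0): cRe => nRe; move/cvgrPdist_le/(_ _ e0): cIm => nIm.
  exists ([set z | `|z0.1 * cos z0.2 - z.1 * cos z.2| <= 2^-1 / c / 2 /\
                   `|z0.1 * sin z0.2 - z.1 * sin z.2| <= 2^-1 / c / 2],
          [set M | 2 * rnorm y <= M]).
    split; first exact: filterI nRe nIm.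
    by apply: nbhs_pinfty_ge; exact: num_real.
  move=> [z M] [/= [zRe zIm] yM].
  have [|z' [zl zr zy]] := @resolvent_perturb (mu z0) (mu z) y yl yr.
    apply: le_trans (_ : 2^-1 / c * (rnorm y * rnorm x) <= _).
      rewrite ler_wpM2r ?mulr_ge0 ?rnorm_ge0 // [leRHS]splitr.
      apply: le_trans (normc_le_Re_Im _) _.
      have -> : complex.Re (mu z - mu z0) = z.1 * cos z.2 - z0.1 * cos z0.2.
        by rewrite -!muRe raddfB.
      have -> : complex.Im (mu z - mu z0) = z.1 * sin z.2 - z0.1 * sin z0.2.
        by rewrite -!muIm raddfB.
      by apply: lerD; rewrite distrC.
    rewrite mulrAC ler_pdivrMr // ler_wpM2l //.
    by rewrite lerDl.
  by exists z'; split => //; exact: le_trans yM.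
(* [KM] applies only strictly above [M]. *)
exists (M + 1) => s t s01 t01; apply: (KM (M + 1) _ (s, t)); first by rewrite ltrDl.
by split; rewrite /= in_itv.
Qed.

(** As [om j ^+ n = 1], multiplying [y j] by [1 - mu ^+ n *: x ^+ n] gives the geometric sum of
    [(mu * om j) *: x]. Summing over [j] kills every power except the zeroth. *)
Lemma resolvent_average (mu : R[i]) (n : nat) (y : 'I_n -> bop V) : (0 < n)%N ->
    (forall j : 'I_n, y j * (1 - (mu * cis (pi *+ 2 / n%:R *+ j)) *: x) = 1) ->
  (n%:R^-1 *: \sum_j y j) * (1 - (mu ^+ n) *: x ^+ n) = 1.
Proof.
move=> n0 yl; have nn0 : n%:R != 0 :> R[i] by rewrite pnatr_eq0 -lt0n.
pose om (j : nat) : R[i] := cis (pi *+ 2 / n%:R *+ j).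
have ys (j : 'I_n) : y j * (1 - (mu ^+ n) *: x ^+ n) =
    \sum_(k < n) (om j ^+ k) *: (mu *: x) ^+ k.
  have -> : mu ^+ n *: x ^+ n = ((mu * om j) *: x) ^+ n.
    rewrite bopZX exprMn [om j ^+ n]cisX -mulrnA mulnC mulrnA.
    rewrite -(mulr_natr (_ / _)) divfK ?pnatr_eq0 -?lt0n // -cisX.
    by rewrite /cis cos2pi sin2pi expr1n mulr1.
  rewrite -opprB subrX1 -mulNr opprB mulrA yl mul1r; apply: eq_bigr => k _.
  by rewrite [mu * _]mulrC -scalerA [LHS]bopZX.
rewrite bopZl mulr_suml (eq_bigr _ (fun j _ => ys j)) exchange_big /=.
rewrite (eq_bigr (fun k : 'I_n => (\sum_(j < n) om j ^+ k) *: (mu *: x) ^+ k)).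
  case: n n0 nn0 {y yl ys} @om => // n _ nn0 om.
  rewrite big_ord_recl [X in _ + X]big1 ?addr0 => [|k _].
    under eq_bigr do rewrite expr0.
    by rewrite sumr_const card_ord expr0 scalerA mulVf // scale1r.
  by rewrite sum_cisX ?scale0r //= /bump leq0n add1n ltnS.
by move=> k _; rewrite scaler_suml.
Qed.

End Resolvent.

(** * The spectral radius formula *)

(** Cut [[0, m]] into [K.+1] pieces of length [e <= d / 2]. From [k * e] the hypothesis reaches
    [k.+2 * e] with bound 3; falling back to [k.+1 * e] multiplies by [q ^+ n] with [q < 1],
    eventually below [15^-1], which restores [5^-1]. The last step goes from [K * e] to [m]. *)
Lemma near_le_by_steps {R : realType} (u : nat -> R) (m d : R) :
    0 <= m -> 0 < d -> (forall n, 0 <= u n) ->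
    (forall s0 s1 n, 0 <= s0 -> s0 <= s1 -> s1 <= m -> s1 - s0 <= d -> (0 < n)%N ->
      s0 ^+ n * u n <= 5^-1 -> s1 ^+ n * u n <= 3) ->
  \forall n \near \oo, m ^+ n * u n <= 3.
Proof.
move=> m0 d0 u0 step.
have [K Kd] : exists K : nat, m / K.+1%:R <= d / 2.
  have dm : 0 <= m / (d / 2) by rewrite divr_ge0 // divr_ge0 // ltW.
  exists (Num.truncn (m / (d / 2))).
  rewrite ler_pdivrMr ?ltr0n // mulrC -ler_pdivrMr ?divr_gt0 //.
  by rewrite ltW // truncnS_gt.
set e := m / K.+1%:R in Kd.
have e0 : 0 <= e by rewrite divr_ge0.
have claim k : (k <= K)%N -> \forall n \near \oo, (k%:R * e) ^+ n * u n <= 5^-1.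
  elim: k => [_|k IH kK].
    near=> n; rewrite mul0r expr0n gtn_eqF ?mul0r ?invr_ge0 //.
    by near: n; exact: nbhs_infty_gt.
  pose q : R := k.+1%:R / k.+2%:R.
  have q0 : 0 <= q by rewrite divr_ge0.
  have q1 : q < 1 by rewrite ltr_pdivrMr ?ltr0n // mul1r ltr_nat.
  have /cvgr_le : q ^+ n @[n --> \oo] --> 0 by apply: cvg_expr; rewrite ger0_norm.
  have q15 : 0 < 15^-1 :> R by rewrite invr_gt0.
  move=> /(_ _ q15) qn; have {}IH := IH (ltnW kK).
  near=> n.
  have -> : k.+1%:R * e = q * (k.+2%:R * e) by rewrite mulrA divfK ?pnatr_eq0.
  rewrite exprMn -mulrA.
  have h3 : (k.+2%:R * e) ^+ n * u n <= 3.
    apply: (step (k%:R * e)).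
    - by rewrite mulr_ge0.
    - by rewrite ler_wpM2r // ler_nat ltnW.
    - by rewrite /e mulrCA ler_piMr // ler_pdivrMr ?ltr0n // mul1r ler_nat ltnS.
    - rewrite -mulrBl -natrB ?leqW // -addn2 addKn; move: Kd; lra.
    - by near: n; exact: nbhs_infty_gt.
    - by near: n.
  have -> : 5^-1 = 15^-1 * 3 :> R by lra.
  apply: ler_pM; rewrite ?exprn_ge0 ?mulr_ge0 ?exprn_ge0 ?mulr_ge0 //.
  by near: n.
have {}claim := claim K (leqnn K); near=> n.
have mE : m = K.+1%:R * e by rewrite /e mulrC divfK ?pnatr_eq0.
rewrite mE; apply: (step (K%:R * e)).
- by rewrite mulr_ge0.
- by rewrite ler_wpM2r // ler_nat.
- by rewrite -mE.
- rewrite -mulrBl -natrB // subSn // subnn mul1r; move: Kd d0; lra.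
- by near: n; exact: nbhs_infty_gt.
- by near: n.
Unshelve. all: by end_near. Qed.

Section SpectralRadiusFormula.
Context {R : realType} {V : normedModType R[i]} (x : bop V).
Hypothesis cV : seq_complete V.

Lemma resolvent_identity (mu nu : R[i]) (y z : bop V) :
    y * (1 - mu *: x) = 1 -> (1 - nu *: x) * z = 1 ->
  y - z = (mu - nu) *: (y * x * z).
Proof.
move=> l r; rewrite -bopZl -bopZr scalerBl.
have -> : mu *: x - nu *: x = (1 - nu *: x) - (1 - mu *: x).
  by rewrite opprB [RHS]addrC subrKA.
by rewrite mulrBr l mulrBl -mulrA r mulr1 mul1r.
Qed.

(** By the resolvent identity the averages [F0] and [F1] differ by at most 1/4. From
    [rnorm w0 <= 1/5] follow [rnorm F0 <= 5/4] and [rnorm (F0 - 1) <= 1/4], hence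
    [rnorm (F1 - 1) <= 1/2], [rnorm (1 - w1) <= 2] and [rnorm w1 <= 3]. *)
Lemma resolvent_step (m M s0 s1 : R) (n : nat) :
    (forall s t, 0 <= s <= m -> 0 <= t <= pi *+ 2 ->
      exists y, [/\ y * (1 - (s%:C * cis t) *: x) = 1,
        (1 - (s%:C * cis t) *: x) * y = 1 & rnorm y <= M]) ->
    0 <= s0 -> s0 <= s1 -> s1 <= m -> (s1 - s0) * (M * rnorm x * M) <= 4^-1 ->
    (0 < n)%N -> s0 ^+ n * rnorm (x ^+ n) <= 5^-1 ->
  s1 ^+ n * rnorm (x ^+ n) <= 3.
Proof.
move=> HM s00 s01 s1m ds n0 h0.
pose t (j : 'I_n) : R := pi *+ 2 / n%:R *+ j.
have t01 j : 0 <= t j <= pi *+ 2.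
  have pi2 : 0 <= (pi *+ 2 : R) by rewrite mulrn_wge0 // pi_ge0.
  rewrite /t -mulr_natr mulr_ge0 ?divr_ge0 //= mulrAC.
  by rewrite ler_pdivrMr ?ltr0n // ler_wpM2l // ler_nat ltnW.
have /choice[y0 y0P] j : exists y, [/\ y * (1 - (s0%:C * cis (t j)) *: x) = 1,
    (1 - (s0%:C * cis (t j)) *: x) * y = 1 & rnorm y <= M].
  by apply: HM; rewrite ?t01 // s00 (le_trans s01).
have /choice[y1 y1P] j : exists y, [/\ y * (1 - (s1%:C * cis (t j)) *: x) = 1,
    (1 - (s1%:C * cis (t j)) *: x) * y = 1 & rnorm y <= M].
  by apply: HM; rewrite ?t01 // s1m (le_trans s00).
have f0 : (n%:R^-1 *: \sum_j y0 j) * (1 - (s0%:C ^+ n) *: x ^+ n) = 1.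
  by apply: resolvent_average => // j; case: (y0P j).
have f1 : (n%:R^-1 *: \sum_j y1 j) * (1 - (s1%:C ^+ n) *: x ^+ n) = 1.
  by apply: resolvent_average => // j; case: (y1P j).
have nrn (s : R) : 0 <= s -> rnorm (s%:C ^+ n *: x ^+ n) = s ^+ n * rnorm (x ^+ n).
  by move=> sp; rewrite rnormZ -rmorphXn ger0_norm // ler0c exprn_ge0.
have yd j : rnorm (y1 j - y0 j) <= 4^-1.
  have [l0 r0 b0] := y0P j; have [l1 r1 b1] := y1P j.
  have -> : y1 j - y0 j = ((s1 - s0)%:C * cis (t j)) *: (y1 j * x * y0 j).
    by rewrite (resolvent_identity _ _ _ _ l1 r0) -mulrBl -rmorphB.
  rewrite rnormZ normrM norm_cis mulr1 ger0_norm ?ler0c ?subr_ge0 //=.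
  apply: le_trans ds; rewrite ler_wpM2l ?subr_ge0 //.
  apply: le_trans (rnorm_bopM _ _) _; apply: ler_pM; rewrite ?rnorm_ge0 //.
  apply: le_trans (rnorm_bopM _ _) _; apply: ler_wpM2r; rewrite ?rnorm_ge0 //.
have fd : rnorm (n%:R^-1 *: (\sum_j y1 j) - n%:R^-1 *: (\sum_j y0 j)) <= 4^-1.
  rewrite -scalerBr -sumrB rnormZ.
  have -> : complex.Re `|(n%:R^-1 : R[i])| = n%:R^-1.
    by apply: complexI; rewrite -cnormE normfV normr_nat fmorphV rmorph_nat.
  rewrite mulrC ler_pdivrMr ?ltr0n //; apply: le_trans (rnorm_sum _ _ _ _) _.
  apply: le_trans (ler_sum _ (fun j _ => yd j)) _.
  by rewrite sumr_const card_ord mulr_natr.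
move: f0 f1 fd; set F0 := n%:R^-1 *: _; set F1 := n%:R^-1 *: _ => f0 f1 fd.
rewrite -(nrn _ s00) in h0; rewrite -(nrn _ (le_trans s00 s01)).
set w0 := _ *: _ in f0 h0; set w1 := _ *: _ in f1 *.
(* F0 and F1 are the inverses of 1 - w0 and 1 - w1.  F0 is close to 1 since w0
   is small, hence so is F1, and then its inverse 1 - w1 is bounded. *)
have F0b := rnorm_left_inverse _ _ f0.
have F01 : F0 - 1 = F0 * w0 by rewrite -f0 mulrBr mulr1 opprB addrC subrK.
have F1b : rnorm (F1 - 1) <= 2^-1.
  rewrite -[F1](subrK F0) -addrA F01.
  apply: le_trans (rnormD _ _) _.
  have := rnorm_bopM F0 w0; have := rnorm_ge0 F0; have := rnorm_ge0 w0.
  move: F0b fd h0; move: (rnorm _) (rnorm _) (rnorm _) => a b c; nra.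
have gb : rnorm (1 - w1) <= 2.
  (* Taking norms gives [rnorm (1 - w1) <= 1 + rnorm (1 - w1) / 2]. *)
  have E : 1 - w1 = 1 - (F1 - 1) * (1 - w1) by rewrite mulrBl mul1r f1 subKr.
  have := rnorm_bopM (F1 - 1) (1 - w1); have := rnorm_ge0 (1 - w1).
  have : rnorm (1 - w1) <= 1 + rnorm ((F1 - 1) * (1 - w1)).
    by rewrite {1}E; apply: le_trans (rnormB _ _) _; rewrite lerD2r rnorm_bop1.
  move: F1b; move: (rnorm _) (rnorm _) (rnorm _) => a b c; nra.
rewrite -[w1]opprK -[- w1](addKr 1) opprD opprK.
apply: le_trans (rnormB _ _) _; have := @rnorm_bop1 R V; move: gb; lra.
Qed.

(** The lower bound holds with constant 1. For the upper one, [s > r] makes the resolvent exist on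
    the disc of radius [s^-1], and stepping out to its boundary bounds
    [s^-1 ^+ n * rnorm (x ^+ n)]. *)
Lemma growth_rate_exp :
  growth_rate (fun n => rnorm (x ^+ n)) (spectral_radius x).
Proof.
split; [exact: spectral_radius_ge0|by move=> n; exact: rnorm_ge0| |].
  exists 1; rewrite ?ltr01 //; near=> n; rewrite mul1r.
  by apply: spectral_radius_exp_le => //; near: n; exact: nbhs_infty_gt.
move=> s rs; have s0 : 0 < s by exact: le_lt_trans (spectral_radius_ge0 _ _) rs.
have rs1 : s^-1 * spectral_radius x < 1 by rewrite mulrC ltr_pdivrMr // mul1r.
have [M HM] := resolvent_bounded x cV _ (fun mu => resolvent_exists x cV _ mu rs1).
pose c := M * rnorm x * M + 1.
have c0 : 0 < c.
  (* The sign of [M] is not known here, so [M] is paired with itself into a square. *)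
  by rewrite ltr_wpDl // mulrAC mulr_ge0 ?rnorm_ge0 // -expr2 sqr_ge0.
have sV0 : 0 <= s^-1 by rewrite invr_ge0 ltW.
have near3 : \forall n \near \oo, s^-1 ^+ n * rnorm (x ^+ n) <= 3.
  apply: (@near_le_by_steps _ _ _ (4^-1 / c)) => //.
  - by rewrite divr_gt0.
  - by move=> n; exact: rnorm_ge0.
  - move=> s0' s1 n s0p s01 s1m d; apply: resolvent_step HM _ _ _ _ => //.
    move: d; rewrite ler_pdivlMr // => /(le_trans _); apply.
    by rewrite ler_wpM2l ?subr_ge0 // lerDl.
exists 3; apply: filterS near3 => n.
by rewrite exprVn mulrC ler_pdivrMr ?exprn_gt0.
Unshelve. all: by end_near. Qed.

End SpectralRadiusFormula.

(** * Weighted shifts *)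

Lemma growth_rate_unique {R : realType} (u : nat -> R) (r r' : R) :
  growth_rate u r -> growth_rate u r' -> r = r'.
Proof.
move=> /growth_rate_cvg ur /growth_rate_cvg ur'.
exact: (cvg_unique _ ur ur').
Qed.

(** Since [(x * y) ^+ n.+1 = x * (y * x) ^+ n * y], the powers of both products have the same growth
    rate. *)
Lemma spectral_radiusC {R : realType} {V : normedModType R[i]} (x y : bop V) :
  seq_complete V -> spectral_radius (x * y) = spectral_radius (y * x).
Proof.
move=> cV; apply: (@growth_rate_unique _ (fun n => rnorm ((x * y) ^+ n))).
  exact: growth_rate_exp.
have swap (z w : bop V) n : (z * w) ^+ n.+1 = z * (w * z) ^+ n * w.
  elim: n => [|n IH]; first by rewrite expr1 expr0 mulr1.
  by rewrite exprS IH exprS !mulrA.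
have bound (z w : bop V) n :
    rnorm ((z * w) ^+ n.+1) <= rnorm z * rnorm w * rnorm ((w * z) ^+ n).
  rewrite swap mulrAC; apply: le_trans (rnorm_bopM _ _) _.
  by rewrite ler_wpM2r ?rnorm_ge0 // rnorm_bopM.
apply: (growth_rate_transfer (fun n => rnorm ((y * x) ^+ n)) _ _
  (rnorm x * rnorm y)); last exact: growth_rate_exp.
- by move=> n; exact: rnorm_ge0.
- by move=> n; rewrite mulrC (mulrC (rnorm x)) mulrC; exact: bound.
- exact: bound.
Qed.

Section WeightedShift.
Context {R : realType} {E : normedModType R[i]} {A : subalgebra E}.
Context {T S : bop E} (h : abstract_weighted_shift A T S).
Implicit Types a b : A.

Let alpha := shift_endo h.

Lemma rnorm_subalgM a b : rnorm (a * b) <= rnorm a * rnorm b.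
Proof. exact: (rnorm_bopM (subalg_val a) (subalg_val b)). Qed.

Lemma rnorm_iter_shift_endo n a : rnorm (iter n alpha a) <= rnorm a.
Proof.
have [T1 S1 _ _] := aws_adjoint h.
elim: n => //= n IH; apply: le_trans _ IH; set b := iter n _ _.
change (rnorm (T * subalg_val b * S) <= rnorm (subalg_val b)).
apply: le_trans (rnorm_bopM _ _) _.
apply: le_trans (_ : rnorm (T * subalg_val b) <= _).
  by rewrite ler_piMr ?rnorm_ge0.
apply: le_trans (rnorm_bopM _ _) _.
by rewrite ler_piMl ?rnorm_ge0.
Qed.

(** Write [T] as [T * S * T] and move [S * T] past [b]. *)
Lemma shift_endo_intertwine b : T * subalg_val b = subalg_val (alpha b) * T.
Proof.
have [_ _ TST _] := aws_adjoint h.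
change (T * subalg_val b = T * subalg_val b * S * T).
by rewrite -{1}TST -!mulrA [S * _]mulrA (aws_commute h (subalg_valP b)).
Qed.

Lemma iter_shift_endo_intertwine n b :
  T ^+ n * subalg_val b = subalg_val (iter n alpha b) * T ^+ n.
Proof.
elim: n => [|n IH]; first by rewrite expr0 mul1r mulr1.
by rewrite exprS -mulrA IH mulrA iterS shift_endo_intertwine mulrA.
Qed.

Lemma iter_shift_endoE n b :
  subalg_val (iter n alpha b) = T ^+ n * subalg_val b * S ^+ n.
Proof.
elim: n b => [|n IH] b; first by rewrite !expr0 mul1r mulr1.
by rewrite exprSr exprS iterSr IH !mulrA.
Qed.

Lemma iter_shift_endoM n a b :
  iter n alpha (a * b) = iter n alpha a * iter n alpha b.
Proof. by elim: n => //= n ->; exact: shift_endoM. Qed.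

Let P a n : A := \prod_(i < n) iter i alpha a.

Lemma weighted_shift_exp a n :
  (subalg_val a * T) ^+ n = subalg_val (P a n) * T ^+ n.
Proof.
elim: n => [|n IH]; first by rewrite /P big_ord0 !expr0 mulr1.
rewrite exprSr IH /P big_ord_recr /= exprSr mulrA -(mulrA _ (T ^+ n)).
by rewrite iter_shift_endo_intertwine !mulrA.
Qed.

Lemma weighted_endo_exp a n b :
  (weighted_endo h a ^+ n) b = P a n * iter n alpha b.
Proof.
elim: n b => [|n IH] b; first by rewrite /P big_ord0 expr0 mul1r.
rewrite exprSr.
change ((weighted_endo h a ^+ n) (a * alpha b) = P a n.+1 * iter n.+1 alpha b).
by rewrite IH /P big_ord_recr /= iter_shift_endoM -iterSr mulrA.
Qed.

Lemma rnorm_contraction_exp (U : bop E) n : rnorm U <= 1 -> rnorm (U ^+ n) <= 1.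
Proof.
move=> U1; apply: le_trans (rnorm_bopX _ _) _.
by rewrite exprn_ile1 ?rnorm_ge0.
Qed.

(** One bound is [P_(n+1) T^(n+1) = (a T)^(n+1)] with [T] contractive; the other is
    [P_(n+2) = (a T)^n a S^n alpha^(n+1)(a)], where the two extra factors [a] cost at most
    [c * c]. *)
Lemma growth_rate_weighted_prod a (r : R) :
  growth_rate (fun n => rnorm ((subalg_val a * T) ^+ n)) r ->
  growth_rate (fun n => rnorm (P a n.+1)) r.
Proof.
have [T1 S1 _ _] := aws_adjoint h.
(* Being at least 1 and at least [rnorm a], [c] lets the single constant [c * c] serve both
   bounds. *)
pose c := rnorm a + 1.
have ac : rnorm a <= c by rewrite lerDl.
have c1 : 1 <= c by rewrite lerDr rnorm_ge0.
have c0 : 0 <= c by exact: le_trans ler01 c1.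
apply: (growth_rate_transfer _ _ _ (c * c)) => n; first exact: rnorm_ge0.
- rewrite weighted_shift_exp; apply: le_trans (rnorm_bopM _ _) _.
  rewrite mulrC ler_wpM2r ?rnorm_ge0 //.
  apply: le_trans (rnorm_contraction_exp _ _ T1) _.
  by rewrite -[1]mulr1 ler_pM.
- rewrite /P big_ord_recr -/(P a n.+1) -mulrA [leRHS]mulrC.
  apply: le_trans (rnorm_subalgM _ _) _; apply: ler_pM; rewrite ?rnorm_ge0 //.
    rewrite /P big_ord_recr /= -/(P a n).
    change (rnorm (subalg_val (P a n) * subalg_val (iter n alpha a))
      <= c * rnorm ((subalg_val a * T) ^+ n)).
    rewrite iter_shift_endoE !mulrA -weighted_shift_exp.
    apply: le_trans (rnorm_bopM _ _) _.
    apply: le_trans (ler_wpM2l (rnorm_ge0 _) (rnorm_contraction_exp _ n S1)) _.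
    rewrite mulr1 mulrC; apply: le_trans (rnorm_bopM _ _) _.
    by rewrite ler_wpM2l ?rnorm_ge0.
  exact: le_trans (rnorm_iter_shift_endo _ _) ac.
Qed.

(** [alpha] is contractive, so [P_(n+1)] dominates [(a alpha)^(n+1)]. Conversely
    [P_(n+2) = P_(n+1) alpha^(n+1)(a)], and [P_(n+1)] is a value of [(a alpha)^n]. *)
Lemma growth_rate_weighted_endo a (r : R) :
  growth_rate (fun n => rnorm (P a n.+1)) r ->
  growth_rate (fun n => rnorm (weighted_endo h a ^+ n)) r.
Proof.
pose c := rnorm a + 1.
have ac : rnorm a <= c by rewrite lerDl.
have c1 : 1 <= c by rewrite lerDr rnorm_ge0.
have c0 : 0 <= c by exact: le_trans ler01 c1.
apply: (growth_rate_transfer _ _ _ (c * c)) => n; first exact: rnorm_ge0.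
- rewrite /P big_ord_recr /= -/(P a n.+1) [leRHS]mulrC mulrA.
  apply: le_trans (rnorm_subalgM _ _) _; apply: ler_pM; rewrite ?rnorm_ge0 //.
    (* Evaluation is at [a] and not at 1, since [alpha(1) = T * S] may differ from 1. *)
    have -> : P a n.+1 = (weighted_endo h a ^+ n) a.
      by rewrite weighted_endo_exp /P big_ord_recr.
    apply: le_trans (opnormP _ _) _.
    by rewrite -rnorm_bop ler_wpM2l ?rnorm_ge0.
  exact: le_trans (rnorm_iter_shift_endo n.+1 a) ac.
- rewrite rnorm_bop; apply: opnorm_le => b b1; rewrite weighted_endo_exp.
  apply: le_trans (rnorm_subalgM _ _) _; rewrite mulrC.
  apply: ler_wpM2r; rewrite ?rnorm_ge0 //.
  apply: le_trans (rnorm_iter_shift_endo _ _) (le_trans b1 _).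
  by rewrite -[1]mulr1 ler_pM.
Qed.

End WeightedShift.

Theorem proposition2p18 (R : realType) (E : completeNormedModType R[i])
    (A : subalgebra E) (T S : bop E) (h : abstract_weighted_shift A T S)
    (a : A) :
  let alpha := shift_endo h in
  [/\ rnorm (\prod_(i < n.+1) iter i alpha a) `^ n%:R^-1 @[n --> \oo]
        --> spectral_radius (subalg_val a * T),
      rnorm (weighted_endo h a ^+ n) `^ n%:R^-1 @[n --> \oo]
        --> spectral_radius (subalg_val a * T),
      closed (subalg_set A) ->
        spectral_radius (weighted_endo h a) =
        spectral_radius (subalg_val a * T) &
      forall k : nat,
      [/\ spectral_radius (subalg_val (iter k alpha a) * T) =
            spectral_radius (subalg_val a * T),
          rnorm (weighted_endo h (iter k alpha a) ^+ n) `^ n%:R^-1 @[n --> \oo]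
            --> spectral_radius (subalg_val a * T) &
          closed (subalg_set A) ->
            spectral_radius (weighted_endo h (iter k alpha a)) =
            spectral_radius (subalg_val a * T)]].
Proof.
move=> alpha; have cE := completeNormedMod_seq_complete E.
have rate b := growth_rate_weighted_prod h b _
  (growth_rate_exp (subalg_val b * T) cE).
have endo b := growth_rate_weighted_endo h b _ (rate b).
(* Closedness makes [A] complete, so the spectral radius formula holds in B(A) and can be compared
   with the rate [endo b]. *)
have closed_endo b : closed (subalg_set A) ->
    spectral_radius (weighted_endo h b) = spectral_radius (subalg_val b * T).
  move=> /(subalgebra_seq_complete A cE) cA.
  exact: growth_rate_unique (growth_rate_exp _ cA) (endo b).
split; [exact: growth_rate_cvg|exact: growth_rate_cvg|exact: closed_endo|] => k.
(* Induction on [k]: [alpha(b) T = T b], and [T b] has the spectral radius of [b T]. *)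
have rk : spectral_radius (subalg_val (iter k alpha a) * T) =
    spectral_radius (subalg_val a * T).
  elim: k => //= k IH.
  by rewrite -(shift_endo_intertwine h) spectral_radiusC.
split=> //; last by rewrite -rk; exact: closed_endo.
by rewrite -rk; exact: growth_rate_cvg.
Qed.
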